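(* Let $(X,d)$ be a compact metric space and let $F=\{f_1,\dots,f_m\}$ ($m\ge 1$) be an $m$-tuple of continuous maps $X\to X$ such that $F(X)=X$ and $R(F^{N+1})=R(F^N)$ for some $N\in\mathbb{N}$. Let $k\ge 2$ be an integer. Then $F$ is Kato's chaotic if and only if $F^k$ is Kato's chaotic.
   Context: $\mathbb{N}=\{1,2,3,\dots\}$. $\mathcal{K}(X)$ is the set of nonempty compact subsets of $X$ with the Hausdorff metric $d_H(A,B)=\max\{\sup_{x\in A}\inf_{y\in B}d(x,y),\ \sup_{y\in B}\inf_{x\in A}d(x,y)\}$. For $n\in\mathbb{N}$, $F^n:X\to\mathcal{K}(X)$ is $F^n(x)=\{f_{i_1}\circ f_{i_2}\circ\cdots\circ f_{i_n}(x)\mid i_1,\dots,i_n\in\{1,\dots,m\}\}$, and for $A\subseteq X$, $F^n(A)=\bigcup_{a\in A}F^n(a)$ (so $F(X)=X$ means $\bigcup_i f_i(X)=X$). $R(F^n)=\{F^n(x)\mid x\in X\}\subseteq\mathcal{K}(X)$. $F^k$ is regarded as the multiple mapping consisting of all compositions $f_{i_1}\circ\cdots\circ f_{i_k}$; thus its $n$-th iterate is $(F^k)^n=F^{kn}$. For a multiple mapping $G$ on $X$ (here $G=F$ or $G=F^k$): Sensitive: there is $\delta>0$ such that for any nonempty open set $U\subset X$ there exist $x,y\in U$ and $n\in\mathbb{N}$ with $d_H(G^n(x),G^n(y))>\delta$. Accessible: for any $\varepsilon>0$ and any nonempty open sets $U,V\subset X$ there exist $x\in U$, $y\in V$ and $n\in\mathbb{N}$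 with $d_H(G^n(x),G^n(y))<\varepsilon$. Kato's chaotic: sensitive and accessible. *)

(* Defs.v *)
From HB Require Import structures.
From mathcomp Require Import all_boot all_order all_algebra.
From mathcomp Require Import all_classical all_reals topology.

Set Implicit Arguments.
Unset Strict Implicit.
Unset Printing Implicit Defensive.

Import Order.TTheory GRing.Theory Num.Theory.
Local Open Scope classical_set_scope.
Local Open Scope ring_scope.

(* [sup] and [inf] are those of the reals, with junk values on unbounded or
   empty sets; on nonempty compact A and B no junk value is involved. *)
Definition hausdorff_dist (R : realType) (X : metricType R) (A B : set X) : R :=
  Num.max (sup [set inf [set mdist x y | y in B] | x in A])
          (sup [set inf [set mdist x y | x in A] | y in B]).

(* A multiple mapping {f_i} on X is a family f : I -> X -> X over a finite index
   type.  The word [:: i1; ...; in] stands for f_i1 \o ... \o f_in, so f_in is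
   applied first. *)
Definition word_comp (I : Type) (X : Type) (f : I -> X -> X) (w : seq I) :
    X -> X :=
  foldr (fun i g => f i \o g) id w.

Definition mm_iter (I : Type) (X : Type) (f : I -> X -> X) (n : nat) (x : X) :
    set X :=
  [set word_comp f w x | w in [set: n.-tuple I]].

Definition mm_image (I : Type) (X : Type) (f : I -> X -> X) (n : nat)
    (A : set X) : set X :=
  \bigcup_(a in A) mm_iter f n a.

Definition mm_range (I : Type) (X : Type) (f : I -> X -> X) (n : nat) :
    set (set X) :=
  range (mm_iter f n).

(* F^k as a multiple mapping in its own right, indexed by the words of length k;
   see [mm_iter_power] for (F^k)^n = F^(k n). *)
Definition mm_power (I : Type) (X : Type) (f : I -> X -> X) (k : nat) :
    k.-tuple I -> X -> X :=
  fun w => word_comp f w.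
Arguments mm_power {I X} f k _ _ : simpl never.

Definition sensitive (R : realType) (X : metricType R) (I : finType)
    (f : I -> X -> X) : Prop :=
  exists2 delta : R, 0 < delta &
    forall U : set X, open U -> U !=set0 ->
      exists x y : X, exists n : nat,
        [/\ U x, U y, (0 < n)%N &
            delta < hausdorff_dist (mm_iter f n x) (mm_iter f n y)].

Definition accessible (R : realType) (X : metricType R) (I : finType)
    (f : I -> X -> X) : Prop :=
  forall eps : R, 0 < eps ->
    forall U V : set X, open U -> U !=set0 -> open V -> V !=set0 ->
      exists x y : X, exists n : nat,
        [/\ U x, V y, (0 < n)%N &
            hausdorff_dist (mm_iter f n x) (mm_iter f n y) < eps].

Definition kato_chaotic (R : realType) (X : metricType R) (I : finType)
    (f : I -> X -> X) : Prop :=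
  sensitive f /\ accessible f.

Lemma mm_iter_nonempty (I : Type) (X : Type) (f : I -> X -> X) (i : I) n x :
  mm_iter f n x !=set0.
Proof. by exists (word_comp f (nseq_tuple n i) x); exists (nseq_tuple n i). Qed.

Lemma mm_iter_compact (R : realType) (X : metricType R) (I : finType)
  (f : I -> X -> X) n x : compact (mm_iter f n x).
Proof. by apply: finite_compact; apply: finite_image; exact: finite_finset. Qed.

Lemma word_comp_cat (I : Type) (X : Type) (f : I -> X -> X) (v w : seq I) :
  word_comp f (v ++ w) = word_comp f v \o word_comp f w.
Proof. by elim: v => //= i v ->. Qed.

Lemma mm_iter_power (I : Type) (X : Type) (f : I -> X -> X) (k n : nat) :
  mm_iter (mm_power f k) n = mm_iter f (k * n).
Proof.
have S q x (y : X) : mm_iter f q x y <->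
    exists2 w : seq I, size w = q & word_comp f w x = y.
  split=> [[w _ <-]|[w wq <-]]; first by exists w; rewrite ?size_tuple.
  by rewrite -wq; exists (in_tuple w).
have E m (u : seq (m.-tuple I)) :
    word_comp (mm_power f m) u = word_comp f (flatten (map val u)).
  by elim: u => //= w u ->; rewrite word_comp_cat.
have L (u : seq (k.-tuple I)) : size (flatten (map val u)) = (k * size u)%N.
  by elim: u => [|w u IH]; rewrite ?muln0 //= size_cat size_tuple IH mulnS.
apply/funext => x; apply/seteqP; split => y; rewrite /mm_iter /=.
  move=> [u _ <-]; apply/S; exists (flatten (map val u)); last by rewrite E.
  by rewrite L size_tuple.
move/S => [w + <-]; elim: n w => [|n IH] w.
  by rewrite muln0 => /size0nil ->; exists [tuple].
rewrite mulnS => sw.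
have tk : size (take k w) == k.
  by rewrite size_take_min sw; apply/eqP/minn_idPl; exact: leq_addr.
have [u _ uE] := IH (drop k w) ltac:(by rewrite size_drop sw addKn).
exists [tuple of Tuple tk :: u] => //=.
by rewrite uE -[in RHS](cat_take_drop k w) word_comp_cat.
Qed.

(* Main.v *)
Require Import Defs.
From mathcomp Require Import all_boot all_order all_algebra.
From mathcomp Require Import all_classical all_reals topology.

Local Open Scope classical_set_scope.
Local Open Scope ring_scope.

(** The iterates of [F^k] are the iterates [F^(k n)] of [F], so sensitivity and
    accessibility of [F^k] give the same property of [F] with the same points and
    the same constants.

    For the converses the iterates of [F] at times that are not multiples of [k]
    have to be moved to a multiple of [k] at bounded distance.  By compactness
    the maps [f i] are uniformly equicontinuous ([equicontinuous_mdist]), so the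
    map sending a set [A] to the union of the [f i @` A] is uniformly continuous
    for the Hausdorff distance ([hausdorff_dist_step]).  Hence, uniformly in [x],
    [y], [n] and in [r <= k], if [F^n(x)] and [F^n(y)] are close, then so are
    [F^(n + r)(x)] and [F^(n + r)(y)] ([mm_iter_modulus]).
    - Accessibility: if the orbits of [x] and [y] are close at time [n], they
      are still close at the next multiple of [k].
    - Sensitivity: if the orbits of [x] and [y] are far apart at time [n], they
      were already far apart at the previous multiple of [k]; this multiple is
      not [0] as soon as [x] and [y] are chosen close to each other. *)

Import Order.TTheory GRing.Theory Num.Theory.

Lemma finite_has_ubound {R : realType} {E : set R} :
  finite_set E -> has_ubound E.
Proof.
move/finite_seqP => [s ->]; exists (\big[Num.max/0]_(x <- s) x) => x /= xs.
exact: le_bigmax_seq.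
Qed.

(** The two halves of the Hausdorff distance are instances of one expression, for
    the distance and for the distance with its arguments exchanged; hence the
    arbitrary cost [c].  Finiteness of [A] and the bound [0 <= c] keep the [sup]
    and the [inf] away from their junk values. *)
Lemma sup_inf_lt {R : realType} {T U : Type} {c : T -> U -> R} {A : set T}
    {B : set U} {e : R} :
  (forall x y, 0 <= c x y) -> finite_set A -> B !=set0 ->
  sup [set inf [set c x y | y in B] | x in A] < e ->
  forall x, A x -> exists2 y, B y & c x y < e.
Proof.
move=> c0 finA [y0 By0] supe x Ax.
have : inf [set c x y | y in B] < e.
  apply: le_lt_trans supe; apply: ub_le_sup; last by exists x.
  exact/finite_has_ubound/finite_image.
have ne : [set c x y | y in B] !=set0 by exists (c x y0); exists y0.
by case/(inf_lt ne) => _ [y By <-]; exists y.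
Qed.

Lemma sup_inf_le {R : realType} {T U : Type} {c : T -> U -> R} {A : set T}
    {B : set U} {e : R} :
  (forall x y, 0 <= c x y) -> A !=set0 ->
  (forall x, A x -> exists2 y, B y & c x y <= e) ->
  sup [set inf [set c x y | y in B] | x in A] <= e.
Proof.
move=> c0 [x0 Ax0] H; apply: ge_sup.
  by exists (inf [set c x0 y | y in B]); exists x0.
move=> _ [x Ax <-]; have [y By cxy] := H x Ax.
apply: le_trans cxy; apply: ge_inf; last by exists y.
by exists 0 => _ [z _ <-].
Qed.

Section HausdorffDistance.
Context {R : realType} {X : metricType R}.
Implicit Types (A B : set X) (e : R).

Lemma hausdorff_dist_ltW {A B e} :
  finite_set A -> finite_set B -> A !=set0 -> B !=set0 ->
  hausdorff_dist A B < e ->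
  (forall x, A x -> exists2 y, B y & mdist x y < e) /\
  (forall y, B y -> exists2 x, A x & mdist x y < e).
Proof.
move=> finA finB A0 B0; rewrite /hausdorff_dist gt_max => /andP[hA hB]; split.
  exact: sup_inf_lt (@mdist_ge0 _ _) finA B0 hA.
exact: (sup_inf_lt (fun y x => mdist_ge0 x y) finB A0 hB).
Qed.

Lemma hausdorff_dist_le {A B e} : A !=set0 -> B !=set0 ->
  (forall x, A x -> exists2 y, B y & mdist x y <= e) ->
  (forall y, B y -> exists2 x, A x & mdist x y <= e) ->
  hausdorff_dist A B <= e.
Proof.
move=> A0 B0 hA hB; rewrite /hausdorff_dist ge_max; apply/andP; split.
  exact: sup_inf_le (@mdist_ge0 _ _) A0 hA.
exact: (sup_inf_le (fun y x => mdist_ge0 x y) B0 hB).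
Qed.

End HausdorffDistance.

(** Heine's theorem for a finite family: around each point one radius works for
    all the maps, and compactness makes this radius uniform. *)
Lemma equicontinuous_mdist {R : realType} {X : metricType R} {I : finType}
    {f : I -> X -> X} {e : R} :
  compact [set: X] -> (forall i, continuous (f i)) -> 0 < e ->
  exists2 d : R, 0 < d &
    forall i x y, mdist x y < d -> mdist (f i x) (f i y) < e.
Proof.
move=> cX cf e0.
pose P (d : R) (x : X) := forall i y, mdist x y < d -> mdist (f i x) (f i y) < e.
have : \forall d \near 0^'+, [set: X] `<=` P d.
  apply: (iffLR (compact_near_coveringP _) cX) => x _.
  have [r /= r0 xr] : exists2 r : R, 0 < r &
      forall z, mdist x z < r -> forall i, mdist (f i x) (f i z) < e / 2.
    have : \forall z \near x, forall i, mdist (f i x) (f i z) < e / 2.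
      apply: filter_forall => i.
      have e2 : 0 < e / 2 by rewrite divr_gt0.
      exact: metricType_numDomainType.cvgr_dist_lt (cf i x) _ e2.
    move/nbhs_ballP => [r /= r0 H]; exists r => // z xz.
    by apply: H; rewrite ballEmdist.
  have r2 : 0 < r / 2 by rewrite divr_gt0.
  exists (ball x (r / 2), [set d | d < r / 2]).
    by split; [exact: nbhsx_ballx r2 | exact: nbhs_right_lt r2].
  move=> [z d] /= [+ dr] i y zy; rewrite ballEmdist /= => xz.
  rewrite (splitr e); apply: le_lt_trans (metric_triangle _ (f i x) _) _.
  rewrite ltrD //.
    rewrite metric_sym; apply: xr; apply: lt_trans xz _.
    by rewrite [ltRHS]splitr ltrDl.
  apply: xr; apply: le_lt_trans (metric_triangle _ z _) _.
  by rewrite (splitr r) ltrD // (lt_trans zy).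
move=> H; near (0 : R)^'+ => d; exists d; first by near: d; exact: nbhs_right_gt.
have Pd : [set: X] `<=` P d by near: d.
by move=> i x y; exact: Pd.
Unshelve. all: by end_near. Qed.

Section MultipleMapping.
Context {R : realType} {X : metricType R} {I : finType} {f : I -> X -> X}.
(* An index [i0] makes the iterates nonempty sets. *)
Context (i0 : I).
Hypothesis cX : compact [set: X].
Hypothesis cf : forall i, continuous (f i).

Lemma mm_iter_finite n x : finite_set (mm_iter f n x).
Proof. by apply: finite_image; exact: finite_finset. Qed.

Lemma mm_iterS n x : mm_iter f n.+1 x = \bigcup_i (f i @` mm_iter f n x).
Proof.
apply/seteqP; split=> [_ [w _ <-]|_ [i _ [_ [w _ <-] <-]]].
  rewrite [w]tuple_eta; exists (thead w) => //.
  by exists (word_comp f (behead_tuple w) x) => //; exists (behead_tuple w).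
by exists [tuple of i :: w].
Qed.

Lemma mm_iter0_dist x y :
  hausdorff_dist (mm_iter f 0 x) (mm_iter f 0 y) <= mdist x y.
Proof.
have m0 (z : X) : mm_iter f 0 z z by exists [tuple].
have m0E (z t : X) : mm_iter f 0 z t -> t = z by case=> w _ <-; rewrite tuple0.
apply: hausdorff_dist_le; [by exists x | by exists y | |].
  by move=> _ /m0E ->; exists y.
by move=> _ /m0E ->; exists x.
Qed.

Lemma hausdorff_dist_step {e : R} : 0 < e -> exists2 d : R, 0 < d &
  forall A B : set X, finite_set A -> finite_set B -> A !=set0 -> B !=set0 ->
    hausdorff_dist A B < d ->
    hausdorff_dist (\bigcup_i (f i @` A)) (\bigcup_i (f i @` B)) < e.
Proof.
move=> e0; have e2 : 0 < e / 2 by rewrite divr_gt0.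
have [d d0 df] := equicontinuous_mdist cX cf e2.
exists d => // A B finA finB A0 B0.
case/(hausdorff_dist_ltW finA finB A0 B0) => hA hB.
have U0 (C : set X) : C !=set0 -> \bigcup_i (f i @` C) !=set0.
  by case=> x Cx; exists (f i0 x); exists i0 => //; exists x.
(* The pointwise estimates only bound the supremum weakly, hence e / 2. *)
apply: (@le_lt_trans _ _ (e / 2)); last by rewrite [ltRHS]splitr ltrDl.
apply: hausdorff_dist_le; [exact: U0 | exact: U0 | |].
  move=> _ [i _ [x Ax <-]]; have [y By xy] := hA x Ax.
  exists (f i y); first by exists i => //; exists y.
  by rewrite ltW // df.
move=> _ [i _ [y By <-]]; have [x Ax xy] := hB y By.
exists (f i x); first by exists i => //; exists x.
by rewrite ltW // df.
Qed.

(** Only finitely many delays [r] occur, so composing moduli of continuity one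
    step at a time still leaves one [d] that serves all starting times [n]. *)
Lemma mm_iter_modulus (k : nat) {e : R} : 0 < e -> exists2 d : R, 0 < d &
  forall r n x y, (r <= k)%N ->
    hausdorff_dist (mm_iter f n x) (mm_iter f n y) < d ->
    hausdorff_dist (mm_iter f (n + r) x) (mm_iter f (n + r) y) < e.
Proof.
elim: k e => [|k IH] e e0.
  by exists e => // r n x y; rewrite leqn0 => /eqP ->; rewrite addn0.
have [d1 d10 step] := hausdorff_dist_step e0.
have [d2 d20 H] := IH d1 d10.
exists (Num.min e d2); first by rewrite lt_min e0.
move=> [|r] n x y rk; rewrite lt_min => /andP[he hd]; first by rewrite addn0.
rewrite addnS !mm_iterS; apply: step; try exact: mm_iter_finite.
- exact: mm_iter_nonempty i0 _ _.
- exact: mm_iter_nonempty i0 _ _.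
- exact: H.
Qed.

(** A separation larger than [e] at time [n] must exceed [d / 2] already at time
    [k * (n %/ k)], by [mm_iter_modulus] with delay [n %% k].  Shrinking [U] to
    diameter less than [d] excludes the time [0]. *)
Lemma sensitive_power {k : nat} : (0 < k)%N ->
  sensitive f <-> sensitive (mm_power f k).
Proof.
move=> k0; split=> [[e e0 H]|[e e0 H]].
  have [d d0 mod_d] := mm_iter_modulus k e0.
  have d2 : 0 < d / 2 by rewrite divr_gt0.
  exists (d / 2) => // U oU [x0 Ux0].
  pose V := U `&` (ball x0 (d / 2))°.
  have oV : open V by apply: openI => //; exact: open_interior.
  have V0 : V !=set0 by exists x0; split => //; exact: nbhsx_ballx.
  have [x [y [n [[Ux Bx] [Uy By] n0 en]]]] := H V oV V0.
  have xyd : mdist x y < d.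
    have := interior_subset Bx; have := interior_subset By.
    rewrite !ballEmdist /= => x0y x0x.
    apply: le_lt_trans (metric_triangle _ x0 _) _.
    by rewrite (splitr d) ltrD // metric_sym.
  have far : d <= hausdorff_dist (mm_iter f (k * (n %/ k)) x)
                                 (mm_iter f (k * (n %/ k)) y).
    rewrite leNgt; apply/negP => /(mod_d (n %% k)%N _ _ _ (ltnW (ltn_pmod n k0))).
    by rewrite mulnC -divn_eq => /(lt_trans en); rewrite ltxx.
  exists x, y, (n %/ k)%N; split => //; last first.
    rewrite mm_iter_power; apply: lt_le_trans far.
    by rewrite [ltRHS]splitr ltrDl.
  rewrite lt0n; apply/eqP => q0; move: far; rewrite q0 muln0 => far.
  by have := le_lt_trans (le_trans far (mm_iter0_dist x y)) xyd; rewrite ltxx.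
exists e => // U oU U0; have [x [y [n [Ux Uy n0 en]]]] := H U oU U0.
exists x, y, (k * n)%N; split => //; first by rewrite muln_gt0 k0.
by rewrite -mm_iter_power.
Qed.

(** Closeness at time [n] persists up to the next multiple of [k], which lies
    [k - n %% k <= k] steps later. *)
Lemma accessible_power {k : nat} : (0 < k)%N ->
  accessible f <-> accessible (mm_power f k).
Proof.
move=> k0; split=> H e e0 U V oU U0 oV V0.
  have [d d0 mod_d] := mm_iter_modulus k e0.
  have [x [y [n [Ux Vy n0 nd]]]] := H d d0 U V oU U0 oV V0.
  exists x, y, (n %/ k).+1; split => //; rewrite mm_iter_power.
  have -> : (k * (n %/ k).+1 = n + (k - n %% k))%N.
    rewrite [in X in (X + _)%N](divn_eq n k) -addnA subnKC; last first.
      exact/ltnW/ltn_pmod.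
    by rewrite mulnS addnC mulnC.
  by apply: mod_d => //; exact: leq_subr.
have [x [y [n [Ux Vy n0 nd]]]] := H e e0 U V oU U0 oV V0.
exists x, y, (k * n)%N; split => //; first by rewrite muln_gt0 k0.
by rewrite -mm_iter_power.
Qed.

End MultipleMapping.

Theorem theorem3 (R : realType) (X : metricType R) (m : nat)
    (f : 'I_m -> X -> X) (k : nat) :
  compact [set: X] ->
  (1 <= m)%N ->
  (forall i : 'I_m, continuous (f i)) ->
  mm_image f 1 [set: X] = [set: X] ->
  (exists2 N : nat, (1 <= N)%N & mm_range f N.+1 = mm_range f N) ->
  (2 <= k)%N ->
  kato_chaotic f <-> kato_chaotic (mm_power f k).
Proof.
move=> cX m1 cf _ _ /ltnW k0; have i0 := Ordinal m1.
have [sP sN] := sensitive_power i0 cX cf k0.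
have [aP aN] := accessible_power i0 cX cf k0.
by split=> -[s a]; split; auto.
Qed.
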